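(* Fix an imprecise probabilities tree with finite state space $\mathscr{X}$. For any gamble (bounded real-valued map) $f$ on $\Omega$ and any situation $s\in\mathscr{X}^{\ast}$, \[\overline{\mathrm{E}}_{\mathrm V}(f\vert s)=\overline{\mathrm{E}}_{\mathrm V}'(f\vert s)=\overline{\mathrm{E}}_{\mathrm V}''(f\vert s),\] where $\overline{\mathrm{E}}_{\mathrm V}$, $\overline{\mathrm{E}}_{\mathrm V}'$ and $\overline{\mathrm{E}}_{\mathrm V}''$ are the game-theoretic upper expectations defined using, respectively, bounded below extended real-valued supermartingales, bounded below real-valued supermartingales, and bounded (above and below) real-valued supermartingales.
   Context: Notation: $\mathbb{N}=\{1,2,\dots\}$, $\mathbb{N}_0=\mathbb{N}\cup\{0\}$, $\overline{\mathbb{R}}=\mathbb{R}\cup\{-\infty,+\infty\}$, with conventions $+\infty-\infty=-\infty+\infty=+\infty$, $0\cdot(\pm\infty)=0$, $\inf\emptyset=+\infty$. For a non-empty set $\mathscr{Y}$, $\overline{\mathscr{L}}(\mathscr{Y})$ is the set of all maps $\mathscr{Y}\to\overline{\mathbb{R}}$ and $\overline{\mathscr{L}}_b(\mathscr{Y})$ the subset of those bounded below by a real constant. Limits and inequalities of functions are pointwise. Local models: $\mathscr{X}$ is a finite non-empty set. $\mathscr{X}^{\ast}=\bigcup_{n\in\mathbb{N}_0}\mathscr{X}^n$ is the set of situations (finite strings, including the empty string $\Box$). An imprecise probabilities tree assigns to each $s\in\mathscr{X}^{\ast}$ a map $\overline{\mathrm{Q}}_s\colon\overline{\mathscr{L}}(\mathscr{X})\to\overline{\mathbb{R}}$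 that is an upper expectation, i.e. satisfies: (E1) $\overline{\mathrm{Q}}_s(c)=c$ for all $c\in\mathbb{R}$; (E2) $\overline{\mathrm{Q}}_s(f+g)\le\overline{\mathrm{Q}}_s(f)+\overline{\mathrm{Q}}_s(g)$ for all $f,g\in\overline{\mathscr{L}}_b(\mathscr{X})$; (E3) $\overline{\mathrm{Q}}_s(\lambda f)=\lambda\overline{\mathrm{Q}}_s(f)$ for all real $\lambda>0$ and $f\in\overline{\mathscr{L}}_b(\mathscr{X})$; (E4) $f\le g\Rightarrow\overline{\mathrm{Q}}_s(f)\le\overline{\mathrm{Q}}_s(g)$ for all $f,g\in\overline{\mathscr{L}}_b(\mathscr{X})$; (E5) $\lim_n\overline{\mathrm{Q}}_s(f_n)=\overline{\mathrm{Q}}_s(\lim_n f_n)$ for every non-decreasing sequence $\{f_n\}_{n\in\mathbb{N}_0}$ of non-negative variables in $\overline{\mathscr{L}}_b(\mathscr{X})$. Global models: $\Omega=\mathscr{X}^{\mathbb{N}}$ is the set of paths; for $\omega\in\Omega$, $\omega^n\in\mathscr{X}^n$ is the string of its first $n$ values; $\Gamma(x_{1:n})=\{\omega\in\Omega:\omega^n=x_{1:n}\}$. For $g,h\colon\Omega\to\overline{\mathbb{R}}$, $g\ge_s h$ means $g(\omega)\ge h(\omega)$ for all $\omega\in\Gamma(s)$. A supermartingale is a map $\mathscr{M}\colon\mathscr{X}^{\ast}\to\overline{\mathbb{R}}$ with $\overline{\mathrm{Q}}_s(\mathscr{M}(s\,\cdot))\le\mathscr{M}(s)$ for all $s\in\mathscr{X}^{\ast}$,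 where $\mathscr{M}(s\,\cdot)\in\overline{\mathscr{L}}(\mathscr{X})$ is $x\mapsto\mathscr{M}(sx)$. $\liminf\mathscr{M}(\omega)=\liminf_{n\to+\infty}\mathscr{M}(\omega^n)$. Let $\overline{\mathbb{M}}_{\mathrm b}$ be the set of supermartingales bounded below by a real constant, $\overline{\mathbb{M}}_{\mathrm b}'$ the subset of the real-valued ones, and $\overline{\mathbb{M}}_{\mathrm b}''$ the subset of those that are real-valued and bounded both below and above. For all $f\colon\Omega\to\overline{\mathbb{R}}$ and $s\in\mathscr{X}^{\ast}$, \[\overline{\mathrm{E}}_{\mathrm V}(f\vert s)=\inf\{\mathscr{M}(s):\mathscr{M}\in\overline{\mathbb{M}}_{\mathrm b},\ \liminf\mathscr{M}\ge_s f\},\] and $\overline{\mathrm{E}}_{\mathrm V}'(f\vert s)$ and $\overline{\mathrm{E}}_{\mathrm V}''(f\vert s)$ are defined by the same formula with $\overline{\mathbb{M}}_{\mathrm b}$ replaced by $\overline{\mathbb{M}}_{\mathrm b}'$ and $\overline{\mathbb{M}}_{\mathrm b}''$, respectively. *)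

(* Defs.v *)
From HB Require Import structures.
From mathcomp Require Import all_boot all_order all_algebra.
From mathcomp Require Import all_classical all_reals all_analysis.
Set Implicit Arguments.
Unset Strict Implicit.
Unset Printing Implicit Defensive.
Import Order.TTheory GRing.Theory Num.Theory.
Import numFieldNormedType.Exports.
Local Open Scope classical_set_scope.
Local Open Scope ring_scope.
Local Open Scope ereal_scope.

Definition bounded_below (R : realType) (Y : Type) (f : Y -> \bar R) : Prop :=
  exists B : R, forall y, B%:E <= f y.

Definition bounded_above (R : realType) (Y : Type) (f : Y -> \bar R) : Prop :=
  exists B : R, forall y, f y <= B%:E.

Definition real_valued (R : realType) (Y : Type) (f : Y -> \bar R) : Prop :=
  forall y, f y \is a fin_num.

Definition gamble (R : realType) (Y : Type) (f : Y -> R) : Prop :=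
  exists B : R, forall y, (`|f y| <= B)%R.

(* The library's sum satisfies +oo + -oo = -oo; this case does not arise in
   [ue_sub], whose arguments are bounded below. *)
Record upper_expectation (R : realType) (X : finType)
    (Q : (X -> \bar R) -> \bar R) : Prop := UpperExpectation {
  ue_const : forall c : R, Q (fun=> c%:E) = c%:E ;
  ue_sub : forall f g, bounded_below f -> bounded_below g ->
    Q (fun x => f x + g x) <= Q f + Q g ;
  ue_homog : forall (l : R) f, (0 < l)%R -> bounded_below f ->
    Q (fun x => l%:E * f x) = l%:E * Q f ;
  ue_mono : forall f g, bounded_below f -> bounded_below g ->
    (forall x, f x <= g x) -> Q f <= Q g ;
  ue_cont : forall f_ : nat -> X -> \bar R,
    (forall n, bounded_below (f_ n)) ->
    (forall n x, 0 <= f_ n x) ->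
    (forall m n, (m <= n)%N -> forall x, f_ m x <= f_ n x) ->
    Q (f_ n) @[n --> \oo] --> Q (fun x => limn (fun n => f_ n x))
}.

(* Situations are [seq X], the empty one being [[::]]. Paths are indexed from
   0: [w i] is the (i+1)-st value of [w]. *)
Definition path_prefix (X : finType) (w : nat -> X) (n : nat) : seq X :=
  mkseq w n.

Definition cylinder (X : finType) (s : seq X) : set (nat -> X) :=
  [set w | path_prefix w (size s) = s].

Definition supermartingale (R : realType) (X : finType)
    (Q : seq X -> (X -> \bar R) -> \bar R) (M : seq X -> \bar R) : Prop :=
  forall s, Q s (fun x => M (rcons s x)) <= M s.

Definition path_liminf (R : realType) (X : finType) (M : seq X -> \bar R)
    (w : nat -> X) : \bar R :=
  limn_einf (fun n => M (path_prefix w n)).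

Definition sm_b (R : realType) (X : finType)
    (Q : seq X -> (X -> \bar R) -> \bar R) : set (seq X -> \bar R) :=
  [set M | supermartingale Q M /\ bounded_below M].

Definition sm_b_real (R : realType) (X : finType)
    (Q : seq X -> (X -> \bar R) -> \bar R) : set (seq X -> \bar R) :=
  [set M | sm_b Q M /\ real_valued M].

Definition sm_bounded_real (R : realType) (X : finType)
    (Q : seq X -> (X -> \bar R) -> \bar R) : set (seq X -> \bar R) :=
  [set M | sm_b_real Q M /\ bounded_above M].

Definition game_upper_over (R : realType) (X : finType)
    (C : set (seq X -> \bar R)) (f : (nat -> X) -> \bar R) (s : seq X)
    : \bar R :=
  ereal_inf [set M s | M in
    [set M | C M /\ forall w, cylinder s w -> f w <= path_liminf M w]].

Definition EV (R : realType) (X : finType)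
    (Q : seq X -> (X -> \bar R) -> \bar R) := game_upper_over (sm_b Q).

Definition EV' (R : realType) (X : finType)
    (Q : seq X -> (X -> \bar R) -> \bar R) := game_upper_over (sm_b_real Q).

Definition EV'' (R : realType) (X : finType)
    (Q : seq X -> (X -> \bar R) -> \bar R) :=
  game_upper_over (sm_bounded_real Q).

(* Main.v *)
Require Import Defs.
From HB Require Import structures.
From mathcomp Require Import all_boot all_order all_algebra.
From mathcomp Require Import all_classical all_reals all_analysis.
Set Implicit Arguments.
Unset Strict Implicit.
Unset Printing Implicit Defensive.
Import Order.TTheory GRing.Theory Num.Theory.
Import numFieldNormedType.Exports.
Local Open Scope classical_set_scope.
Local Open Scope ring_scope.
Local Open Scope ereal_scope.

(** If [f <= B] and [M] is a supermartingale bounded below, then [min M B] is a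
    bounded real-valued supermartingale, by monotonicity of the local models
    and [Q B = B].  It does not exceed [M], and its limit inferior along each
    path is at least the minimum of [B] and that of [M], so it still dominates
    [f]. *)

Lemma limn_einf_sup_einfs (R : realType) (u : (\bar R)^nat) :
  limn_einf u = ereal_sup (range (einfs u)).
Proof. by rewrite limn_einf_lim; apply/cvg_lim => //; exact: cvg_einfs_sup. Qed.

(** By contradiction: if the right-hand side were below both [limn_einf u] and [c], it would be
    below some tail infimum [einfs u n], since [limn_einf u] is the supremum of these. *)
Lemma le_limn_einf_mine (R : realType) (u : (\bar R)^nat) (c : \bar R) :
  mine (limn_einf u) c <= limn_einf (fun n => mine (u n) c).
Proof.
rewrite leNgt; apply/negP; rewrite lt_min => /andP[].
rewrite [X in _ < X]limn_einf_sup_einfs => /ereal_sup_gt[_ [n _ <-] ltn] ltc.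
(* [einfs u n] cut at [c] bounds from below every truncated term of index at least [n], hence also
   the [n]-th tail infimum of the truncated sequence. *)
have : mine (einfs u n) c <= limn_einf (fun n => mine (u n) c).
  rewrite [leRHS]limn_einf_sup_einfs.
  apply: le_trans; last by apply: ereal_sup_ubound; exists n.
  apply: le_ereal_inf_tmp => _ [k nk <-].
  rewrite le_min !ge_min lexx orbT andbT; apply/orP; left.
  by apply: ereal_inf_lbound; exists k.
by rewrite leNgt lt_min ltn ltc.
Qed.

Lemma bounded_below_mine (R : realType) (Y : Type) (f : Y -> \bar R) (c : R) :
  bounded_below f -> bounded_below (fun y => mine (f y) c%:E).
Proof.
move=> [b bf]; exists (Num.min b c) => y.
by rewrite EFin_min le_min !ge_min bf lexx orbT.
Qed.

Lemma sm_bounded_real_mine (R : realType) (X : finType)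
    (Q : seq X -> (X -> \bar R) -> \bar R)
    (HQ : forall s, upper_expectation (Q s)) (M : seq X -> \bar R) (c : R) :
  sm_b Q M -> sm_bounded_real Q (fun s => mine (M s) c%:E).
Proof.
move=> [smM bM].
have bMc := bounded_below_mine c bM.
have Mc_le s : mine (M s) c%:E <= c%:E by rewrite ge_min lexx orbT.
have below_rcons (N : seq X -> \bar R) s :
    bounded_below N -> bounded_below (fun x => N (rcons s x)).
  by move=> [b bN]; exists b.
split; last by exists c.
split; last first.
  move=> s; have [b bMs] := bMc.
  rewrite fin_numElt (lt_le_trans (ltNyr b) (bMs s)).
  exact: le_lt_trans (Mc_le s) (ltry c).
(* Two bounds on the local upper expectation of the truncation: by [M s], comparing with [M], and by
   [c], comparing with the constant [c]. *)
split=> // s; rewrite le_min; apply/andP; split.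
  apply: le_trans (smM s); apply: (ue_mono (HQ s)).
  - exact: below_rcons bMc.
  - exact: below_rcons.
  - by move=> x; rewrite ge_min lexx.
(* Reading [c] as the upper expectation of a constant lets monotonicity apply. *)
rewrite -[leRHS](ue_const (HQ s)); apply: (ue_mono (HQ s)) => //.
- exact: below_rcons bMc.
- by exists c.
Qed.

Lemma le_game_upper_over (R : realType) (X : finType)
    (C D : set (seq X -> \bar R)) (f : (nat -> X) -> \bar R) (s : seq X) :
  C `<=` D -> game_upper_over D f s <= game_upper_over C f s.
Proof.
by move=> CD; apply/ereal_inf_le_tmp/image_subset => M [/CD DM fM]; split.
Qed.

Lemma EV''_le_EV (R : realType) (X : finType)
    (Q : seq X -> (X -> \bar R) -> \bar R)
    (HQ : forall s, upper_expectation (Q s))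
    (f : (nat -> X) -> \bar R) (s : seq X) :
  bounded_above f -> EV'' Q f s <= EV Q f s.
Proof.
move=> [B fB]; apply: le_ereal_inf_tmp => _ [M [smM fM] <-].
apply: ge_ereal_inf; exists (mine (M s) B%:E); last by rewrite ge_min lexx.
exists (fun t => mine (M t) B%:E) => //; split.
  exact: sm_bounded_real_mine.
move=> w sw; apply: le_trans (le_limn_einf_mine _ _).
by rewrite le_min fB andbT; exact: fM.
Qed.

Theorem proposition36 (R : realType) (X : finType) (X_neq0 : (0 < #|X|)%N)
    (Q : seq X -> (X -> \bar R) -> \bar R)
    (HQ : forall s, upper_expectation (Q s))
    (f : (nat -> X) -> R) (Hf : gamble f) (s : seq X) :
  EV Q (fun w => (f w)%:E) s = EV' Q (fun w => (f w)%:E) s /\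
  EV' Q (fun w => (f w)%:E) s = EV'' Q (fun w => (f w)%:E) s.
Proof.
set g := fun w => (f w)%:E.
(* The three classes are nested, and a smaller class has a larger infimum; truncation then closes
   the cycle of inequalities. *)
have le1 : EV Q g s <= EV' Q g s by apply: le_game_upper_over => M [].
have le2 : EV' Q g s <= EV'' Q g s by apply: le_game_upper_over => M [].
have le3 : EV'' Q g s <= EV Q g s.
  apply: EV''_le_EV => //; have [B fB] := Hf; exists B => w.
  by rewrite lee_fin (le_trans (ler_norm _) (fB w)).
split; apply/eqP; rewrite eq_le.
- by rewrite le1 (le_trans le2 le3).
- by rewrite le2 (le_trans le3 le1).
Qed.
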